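(* Let $M\in\mathcal{A}$. (a) The set $\Sigma(M)$ coincides with the normal generalized fan $\Sigma(\mathrm{N}(M))$ of the Newton polytope $\mathrm{N}(M)$. (b) There exist mutually inverse order-reversing bijections $\mathsf{Face}\,\mathrm{N}(M)\leftrightarrow\Sigma(M)$ given by $F\mapsto\sigma_F$ for each $F\in\mathsf{Face}\,\mathrm{N}(M)$ and $\sigma\mapsto\mathrm{N}(M)_\theta$ for each $\sigma\in\Sigma(M)$, taking any $\theta\in\sigma^\circ$. Moreover each $F\in\mathsf{Face}\,\mathrm{N}(M)$ satisfies $\dim_{\mathbb{R}}\sigma_F=n-\dim_{\mathbb{R}}F$.
   Context: $\mathcal{A}$ is an abelian length category (every object has finite length) with only finitely many isoclasses $S(1),\ldots,S(n)$ of simple objects. $K_0(\mathcal{A})_{\mathbb{R}}=K_0(\mathcal{A})\otimes_{\mathbb{Z}}\mathbb{R}=\bigoplus_{i=1}^n\mathbb{R}[S(i)]\simeq\mathbb{R}^n$, and $K_0(\mathcal{A})_{\mathbb{R}}^*=\operatorname{Hom}_{\mathbb{R}}(K_0(\mathcal{A})_{\mathbb{R}},\mathbb{R})\simeq\mathbb{R}^n$ with the Euclidean topology. For $\theta\in K_0(\mathcal{A})_{\mathbb{R}}^*$ and $X\in\mathcal{A}$, write $\theta(X):=\theta([X])$. Semistable torsion pairs. For $\theta\in K_0(\mathcal{A})_{\mathbb{R}}^*$ define full subcategories of $\mathcal{A}$: $\overline{\mathcal{T}}_\theta$ = objects $X$ with $\theta(N)\ge0$ for every factor object $N$ of $X$;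 $\mathcal{F}_\theta$ = objects $X$ with $\theta(L)<0$ for every nonzero subobject $L$ of $X$; $\mathcal{T}_\theta$ = objects $X$ with $\theta(N)>0$ for every nonzero factor object $N$ of $X$; $\overline{\mathcal{F}}_\theta$ = objects $X$ with $\theta(L)\le0$ for every subobject $L$ of $X$. Then $(\overline{\mathcal{T}}_\theta,\mathcal{F}_\theta)$ and $(\mathcal{T}_\theta,\overline{\mathcal{F}}_\theta)$ are torsion pairs, and $\mathcal{W}_\theta:=\overline{\mathcal{T}}_\theta\cap\overline{\mathcal{F}}_\theta$ is a wide subcategory of $\mathcal{A}$, which is an abelian category of finite length. For $M\in\mathcal{A}$, $\overline{\mathrm{t}}_\theta M$ (resp. $\mathrm{t}_\theta M$) is the largest subobject of $M$ lying in $\overline{\mathcal{T}}_\theta$ (resp. $\mathcal{T}_\theta$), $\mathrm{f}_\theta M:=M/\overline{\mathrm{t}}_\theta M$, $\overline{\mathrm{f}}_\theta M:=M/\mathrm{t}_\theta M$, and $\mathrm{w}_\theta M:=\overline{\mathrm{t}}_\theta M/\mathrm{t}_\theta M\in\mathcal{W}_\theta$. For $X\in\mathcal{W}_\theta$, $\mathsf{supp}_\theta X$ is the set of isoclasses of composition factors of $X$ in $\mathcal{W}_\theta$. $M$-TF equivalence. Elements $\theta,\eta\in K_0(\mathcal{A})_{\mathbb{R}}^*$ are $M$-TF equivalent if (i) $\mathrm{t}_\theta M=\mathrm{t}_\eta M$, $\mathrm{w}_\theta M=\mathrm{w}_\eta M$ and $\mathrm{f}_\theta M=\mathrm{f}_\eta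 M$ (equivalently $\mathrm{t}_\theta M=\mathrm{t}_\eta M$ and $\overline{\mathrm{t}}_\theta M=\overline{\mathrm{t}}_\eta M$ as subobjects of $M$), and (ii) $\mathsf{supp}_\theta(\mathrm{w}_\theta M)=\mathsf{supp}_\eta(\mathrm{w}_\eta M)$. $\mathsf{TF}(M)$ is the set of $M$-TF equivalence classes, and $\Sigma(M):=\{\overline{E}\mid E\in\mathsf{TF}(M)\}$ is the set of their closures. Newton polytope: $\mathrm{N}(M):=\mathsf{conv}\{[X]\mid X\text{ is a subobject of }M\}\subset K_0(\mathcal{A})_{\mathbb{R}}$. Normal generalized fan. For a polytope $P$ in $V=\mathbb{R}^n$ and $\theta\in V^*=\operatorname{Hom}_{\mathbb{R}}(V,\mathbb{R})$, put $P_\theta:=\{v\in P\mid\theta(v)=\max\theta(P)\}$, a face of $P$. $\mathsf{Face}\,P$ is the set of all nonempty faces of $P$ (including $P$). For $F\in\mathsf{Face}\,P$ put $\sigma_F:=\{\theta\in V^*\mid F\subset P_\theta\}$, a polyhedral cone. The normal generalized fan of $P$ is $\Sigma(P):=\{\sigma_F\mid F\in\mathsf{Face}\,P\}$. The dimension of a polytope or cone is the dimension of its affine span; $\sigma^\circ$ denotes the relative interior of a cone $\sigma$ (interior in its linear span). Orders on $\mathsf{Face}\,\mathrm{N}(M)$ and $\Sigma(M)$ are inclusion. *)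

(* Defs.v *)
From HB Require Import structures.
From mathcomp Require Import all_boot all_order all_algebra.
From mathcomp Require Import all_classical all_reals topology normedtype.

Set Implicit Arguments.
Unset Strict Implicit.
Unset Printing Implicit Defensive.

Import Order.TTheory GRing.Theory Num.Theory.
Import numFieldNormedType.Exports.

Local Open Scope classical_set_scope.
Local Open Scope ring_scope.

(** * Abelian categories *)

(* [comp g f] is the composite "g after f". *)
Record preadditive := Preadditive {
  obj :> Type;
  hom : obj -> obj -> zmodType;
  idm : forall X, hom X X;
  comp : forall X Y Z, hom Y Z -> hom X Y -> hom X Z;
  compA : forall W X Y Z (h : hom Y Z) (g : hom X Y) (f : hom W X),
    comp h (comp g f) = comp (comp h g) f;
  comp1m : forall X Y (f : hom X Y), comp (idm Y) f = f;
  compm1 : forall X Y (f : hom X Y), comp f (idm X) = f;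
  compDl : forall X Y Z (g g' : hom Y Z) (f : hom X Y),
    comp (g + g') f = comp g f + comp g' f;
  compDr : forall X Y Z (g : hom Y Z) (f f' : hom X Y),
    comp g (f + f') = comp g f + comp g f'
}.

Arguments hom {p} X Y.
Arguments idm {p} X.
Arguments comp {p X Y Z} g f.

Notation "g \oc f" := (comp g f) (at level 40, left associativity).

Section PreadditiveNotions.
Variable A : preadditive.
Implicit Types X Y Z K Q : A.

Definition mono X Y (f : hom X Y) : Prop :=
  forall W (g h : hom W X), f \oc g = f \oc h -> g = h.

Definition epi X Y (f : hom X Y) : Prop :=
  forall Z (g h : hom Y Z), g \oc f = h \oc f -> g = h.

Definition is_iso X Y (f : hom X Y) : Prop :=
  exists g : hom Y X, g \oc f = idm X /\ f \oc g = idm Y.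

Definition isomorphic X Y : Prop := exists f : hom X Y, is_iso f.

Definition is_zero X : Prop :=
  forall Y, (forall f : hom X Y, f = 0) /\ (forall f : hom Y X, f = 0).

Definition is_kernel K X Y (k : hom K X) (f : hom X Y) : Prop :=
  f \oc k = 0 /\
  forall W (g : hom W X), f \oc g = 0 -> exists! h : hom W K, k \oc h = g.

Definition is_cokernel X Y Q (q : hom Y Q) (f : hom X Y) : Prop :=
  q \oc f = 0 /\
  forall Z (g : hom Y Z), g \oc f = 0 -> exists! h : hom Q Z, h \oc q = g.

Definition is_biproduct X Y P (i : hom X P) (j : hom Y P)
    (p : hom P X) (q : hom P Y) : Prop :=
  [/\ p \oc i = idm X, q \oc j = idm Y, q \oc i = 0, p \oc j = 0 &
      i \oc p + j \oc q = idm P].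

(* 0 -> X -> Y -> Z -> 0 *)
Definition short_exact X Y Z (i : hom X Y) (p : hom Y Z) : Prop :=
  is_kernel i p /\ is_cokernel p i.

End PreadditiveNotions.

Record abelian := Abelian {
  abelian_preadditive :> preadditive;
  has_zero : exists X : abelian_preadditive, is_zero X;
  has_biproducts : forall X Y : abelian_preadditive,
    exists P (i : hom X P) (j : hom Y P) (p : hom P X) (q : hom P Y),
      is_biproduct i j p q;
  has_kernels : forall (X Y : abelian_preadditive) (f : hom X Y),
    exists K (k : hom K X), is_kernel k f;
  has_cokernels : forall (X Y : abelian_preadditive) (f : hom X Y),
    exists Q (q : hom Y Q), is_cokernel q f;
  mono_normal : forall (X Y : abelian_preadditive) (f : hom X Y),
    mono f -> exists Z (g : hom Y Z), is_kernel f g;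
  epi_conormal : forall (X Y : abelian_preadditive) (f : hom X Y),
    epi f -> exists W (g : hom W X), is_cokernel f g
}.

(** * Simple objects and composition series *)

Section Length.
Variable A : abelian.
Implicit Types (C : A -> Prop) (X Y S M : A).

(* [C] is a full subcategory, either all of A or a wide one.  A wide
   subcategory is closed under kernels, cokernels and extensions, hence its
   monomorphisms and short exact sequences are those of A between objects
   of [C]. *)
Definition simple_in C S : Prop :=
  [/\ C S, ~ is_zero S &
      forall L (i : hom L S), C L -> mono i -> is_zero L \/ is_iso i].

(* [composition_series C X l]: X has a composition series in [C] whose
   successive factors, from the top, are the members of [l]. *)
Inductive composition_series C : A -> seq A -> Prop :=
| CompositionNil X of C X & is_zero X : composition_series C X [::]
| CompositionCons X Y S (i : hom Y X) (p : hom X S) l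
    of C X & short_exact i p & simple_in C S & composition_series C Y l :
    composition_series C X (S :: l).

(* As a set of objects closed under isomorphism, [composition_factors C X] is
   a set of isoclasses. *)
Definition composition_factors C X : set A :=
  [set S | exists l1 S' l2,
     composition_series C X (l1 ++ S' :: l2) /\ isomorphic S S'].

Definition all_objects : A -> Prop := fun=> True.

Definition length_category : Prop :=
  forall X, exists l, composition_series all_objects X l.

Definition simple_representatives n (S : 'I_n -> A) : Prop :=
  [/\ forall i, simple_in all_objects (S i),
      forall i j, isomorphic (S i) (S j) -> i = j &
      forall T, simple_in all_objects T -> exists i, isomorphic T (S i)].

(* The largest subobject of M lying in [C]; it is only determined up to
   isomorphism of subobjects, hence a predicate on monomorphisms to M. *)
Definition is_largest_subobject C M L (i : hom L M) : Prop :=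
  [/\ mono i, C L &
      forall L' (j : hom L' M), mono j -> C L' -> exists h, i \oc h = j].

End Length.

(** * Grothendieck group *)

Section Grothendieck.
Variables (R : realType) (A : abelian).

Definition exact_additive (G : zmodType) (f : A -> G) : Prop :=
  forall X Y Z (i : hom X Y) (p : hom Y Z), short_exact i p -> f Y = f X + f Z.

(* The universal property of X |-> [X], from A to the real vector space
   K_0(A) (x) R. *)
Definition is_real_K0 (V : lmodType R) (cl : A -> V) : Prop :=
  exact_additive cl /\
  forall (W : lmodType R) (f : A -> W), exact_additive f ->
    exists g : {linear V -> W}, (forall X, g (cl X) = f X) /\
      forall g' : {linear V -> W}, (forall X, g' (cl X) = f X) -> g' =1 g.

(* The identification K_0(A)_R = (+)_i R [S i] = R^n. *)
Definition is_class_map n (S : 'I_n -> A) (cl : A -> 'rV[R]_n) : Prop :=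
  is_real_K0 cl /\ forall i, cl (S i) = delta_mx 0 i.

End Grothendieck.

(** * Polytopes and cones *)

Section Hulls.
Variables (R : realType) (V : vectType R).
Implicit Type C : set V.

Definition convex_hull C : set V :=
  [set x | exists k (a : 'I_k -> R) (v : 'I_k -> V),
     [/\ forall i, C (v i), forall i, 0 <= a i, \sum_i a i = 1 &
         x = \sum_i a i *: v i]].

Definition affine_span C : set V :=
  [set x | exists k (a : 'I_k -> R) (v : 'I_k -> V),
     [/\ forall i, C (v i), \sum_i a i = 1 & x = \sum_i a i *: v i]].

Definition linear_span C : set V :=
  [set x | exists k (a : 'I_k -> R) (v : 'I_k -> V),
     (forall i, C (v i)) /\ x = \sum_i a i *: v i].

Definition has_dim C (d : nat) : Prop :=
  exists (v0 : V) (U : {vspace V}),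
    affine_span C = [set v0 + u | u in [set u | u \in U]] /\ \dim U = d.

End Hulls.

Section Fan.
Variables (R : realType) (n : nat).

(* Row vectors are the elements of V = R^n, column vectors those of V^*. *)
Definition pairing (theta : 'cV[R]_n) (v : 'rV[R]_n) : R := (v *m theta) 0 0.

Definition max_face (P : set 'rV[R]_n) (theta : 'cV[R]_n) : set 'rV[R]_n :=
  [set v | P v /\ forall w, P w -> pairing theta w <= pairing theta v].

Definition Face (P : set 'rV[R]_n) : set (set 'rV[R]_n) :=
  [set F | F !=set0 /\ exists theta, F = max_face P theta].

Definition normal_cone (P F : set 'rV[R]_n) : set 'cV[R]_n :=
  [set theta | F `<=` max_face P theta].

Definition normal_fan (P : set 'rV[R]_n) : set (set 'cV[R]_n) :=
  [set normal_cone P F | F in Face P].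

Definition cone_relint (C : set 'cV[R]_n) : set 'cV[R]_n :=
  [set theta | C theta /\ within (linear_span C) (nbhs theta) C].

End Fan.

(** * M-TF equivalence *)

Section TF.
Variables (R : realType) (A : abelian) (n : nat) (cl : A -> 'rV[R]_n).
Implicit Types (theta eta : 'cV[R]_n) (X M : A).

Definition weight theta X : R := pairing theta (cl X).

Definition Tbar theta X : Prop :=
  forall N (p : hom X N), epi p -> 0 <= weight theta N.

Definition Tstrict theta X : Prop :=
  forall N (p : hom X N), epi p -> ~ is_zero N -> 0 < weight theta N.

Definition Fbar theta X : Prop :=
  forall L (i : hom L X), mono i -> weight theta L <= 0.

Definition Wide theta X : Prop := Tbar theta X /\ Fbar theta X.

Definition supp theta X : set A := composition_factors (Wide theta) X.

(* Two subobjects of M are equal when a single monomorphism represents both: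
   [t] represents t_theta M = t_eta M and [tb] represents
   tbar_theta M = tbar_eta M.  The quotient [W] is then
   w_theta M = w_eta M, and the equality f_theta M = f_eta M of the quotients
   by [tb] is automatic. *)
Definition TF_equiv M theta eta : Prop :=
  exists (T Tb W : A) (t : hom T M) (tb : hom Tb M)
         (u : hom T Tb) (w : hom Tb W),
    [/\ is_largest_subobject (Tstrict theta) t /\
          is_largest_subobject (Tstrict eta) t,
        is_largest_subobject (Tbar theta) tb /\
          is_largest_subobject (Tbar eta) tb,
        tb \oc u = t,
        is_cokernel w u &
        supp theta W = supp eta W].

Definition TF M : set (set 'cV[R]_n) :=
  [set [set eta | TF_equiv M theta eta] | theta in setT].

Definition Sigma M : set (set 'cV[R]_n) := [set closure E | E in TF M].

Definition newton M : set 'rV[R]_n :=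
  convex_hull [set v | exists X (i : hom X M), mono i /\ v = cl X].

End TF.

(* Main.v *)
From HB Require Import structures.
From mathcomp Require Import all_boot all_order all_algebra.
From mathcomp Require Import all_classical all_reals topology normedtype.
Require Import Defs.

Set Implicit Arguments.
Unset Strict Implicit.
Unset Printing Implicit Defensive.

Import Order.TTheory GRing.Theory Num.Theory.
Import numFieldNormedType.Exports.

Local Open Scope classical_set_scope.
Local Open Scope ring_scope.

(** The class of an object of [A] has natural coordinates, its multiplicities of
    simple factors, so the subobjects of [M] have finitely many classes and the
    Newton polytope is the hull of a finite set. A functional [theta] is
    maximal on this polytope exactly at the convex combinations of classes of
    subobjects [X] of [M] of maximal weight ([maximizes]); hence two
    functionals cut out the same face iff they have the same maximizers.

    The heart of the proof is that this is also TF equivalence ([TF_equivP]).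
    If [X] and [Y] are subobjects of [M], then [(X + Y) / Y] is a quotient of
    [X]. Comparing weights, a maximizer of least length is the torsion
    subobject [t] for [Tstrict], a maximizer of greatest length is the torsion
    subobject [tb] for [Tbar], and every maximizer lies between them. The
    quotient [W = tb / t] is semistable, and a subobject of [W] has weight zero
    iff its preimage in [M] is a maximizer. If [theta] and [eta] have the same
    maximizers, they therefore have the same [t] and [tb] and the same
    composition series of [W] in their semistable categories, thus the same
    support. Conversely, suppose that [t], [tb] and the support of [W] agree.
    For a maximizer [X] of [theta], the semistable subobject [X / t] of [W] is
    filtered by members of the support, all of which have weight zero for
    [eta]; thus [X] and [t] have the same weight for [eta], and [X] is a
    maximizer of [eta].

    The rest is convex geometry. The functionals cutting out a given face [F]
    have closure [sigma_F], because [eta + e theta] cuts out [F] whenever [eta]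
    lies in [sigma_F], [theta] cuts out [F] and [e > 0] ([closure_face_class]).
    The inverse of [F |-> sigma_F] sends a cone to the intersection of the
    faces cut out by its elements. Finally, a functional [theta] cutting out
    [F] stays in [sigma_F] under small moves that are constant on [F]
    ([near_normal_cone]): this puts [theta] in the relative interior and makes
    [sigma_F] span the annihilator of the directions of [F]. *)

(** * Kernels, cokernels and subobjects *)

Section AbelianCategory.
Variable A : abelian.
Implicit Types X Y Z W K L M N Q : A.

Lemma comp0m X Y Z (f : hom X Y) : (0 : hom Y Z) \oc f = 0.
Proof. by apply: (addrI ((0 : hom Y Z) \oc f)); rewrite -compDl !addr0. Qed.

Lemma compm0 X Y Z (g : hom Y Z) : g \oc (0 : hom X Y) = 0.
Proof. by apply: (addrI (g \oc (0 : hom X Y))); rewrite -compDr !addr0. Qed.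

Lemma compNm X Y Z (g : hom Y Z) (f : hom X Y) : (- g) \oc f = - (g \oc f).
Proof. by apply/eqP; rewrite -subr_eq0 opprK -compDl addNr comp0m. Qed.

Lemma compmN X Y Z (g : hom Y Z) (f : hom X Y) : g \oc (- f) = - (g \oc f).
Proof. by apply/eqP; rewrite -subr_eq0 opprK -compDr addNr compm0. Qed.

Lemma monoP X Y (f : hom X Y) :
  mono f <-> forall W (g : hom W X), f \oc g = 0 -> g = 0.
Proof.
split=> [f_mono W g fg0 | f0 W g h fgh].
  by apply: f_mono; rewrite fg0 compm0.
by apply/eqP; rewrite -subr_eq0; apply/eqP/f0; rewrite compDr compmN fgh subrr.
Qed.

Lemma epiP X Y (f : hom X Y) :
  epi f <-> forall Z (g : hom Y Z), g \oc f = 0 -> g = 0.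
Proof.
split=> [f_epi Z g gf0 | f0 Z g h fgh].
  by apply: f_epi; rewrite gf0 comp0m.
by apply/eqP; rewrite -subr_eq0; apply/eqP/f0; rewrite compDl compNm fgh subrr.
Qed.

Lemma mono_id X : mono (idm X).
Proof. by move=> W g h; rewrite !comp1m. Qed.

Lemma epi_id X : epi (idm X).
Proof. by move=> W g h; rewrite !compm1. Qed.

Lemma mono_comp X Y Z (g : hom Y Z) (f : hom X Y) :
  mono g -> mono f -> mono (g \oc f).
Proof. by move=> gm fm W h k; rewrite -!compA => /gm/fm. Qed.

Lemma epi_comp X Y Z (g : hom Y Z) (f : hom X Y) :
  epi g -> epi f -> epi (g \oc f).
Proof. by move=> ge fe W h k; rewrite !compA => /fe/ge. Qed.

Lemma mono_compr X Y Z (g : hom Y Z) (f : hom X Y) : mono (g \oc f) -> mono f.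
Proof. by move=> gfm W h k e; apply: gfm; rewrite -!compA e. Qed.

Lemma kernel_mono K X Y (k : hom K X) (f : hom X Y) : is_kernel k f -> mono k.
Proof.
move=> [fk0 ker]; apply/monoP=> W g kg0.
have [|h [_ uniq_h]] := ker W 0; first by rewrite compm0.
by rewrite -(uniq_h g kg0); apply: uniq_h; rewrite compm0.
Qed.

Lemma cokernel_epi X Y Q (q : hom Y Q) (f : hom X Y) : is_cokernel q f -> epi q.
Proof.
move=> [qf0 coker]; apply/epiP=> Z g gq0.
have [|h [_ uniq_h]] := coker Z 0; first by rewrite comp0m.
by rewrite -(uniq_h g gq0); apply: uniq_h; rewrite comp0m.
Qed.

Lemma kernel_lift K X Y (k : hom K X) (f : hom X Y) W (g : hom W X) :
  is_kernel k f -> f \oc g = 0 -> exists h, k \oc h = g.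
Proof. by move=> [_ ker] /ker[h [kh _]]; exists h. Qed.

Lemma cokernel_lift X Y Q (q : hom Y Q) (f : hom X Y) Z (g : hom Y Z) :
  is_cokernel q f -> g \oc f = 0 -> exists h, h \oc q = g.
Proof. by move=> [_ coker] /coker[h [hq _]]; exists h. Qed.

Lemma kernelI K X Y (k : hom K X) (f : hom X Y) :
  mono k -> f \oc k = 0 ->
  (forall W (g : hom W X), f \oc g = 0 -> exists h, k \oc h = g) ->
  is_kernel k f.
Proof.
move=> km fk0 lift; split=> // W g /lift[h kh]; exists h.
by split=> // h' kh'; apply: km; rewrite kh.
Qed.

Lemma mono_kernel_cokernel X Y Q (i : hom X Y) (q : hom Y Q) :
  mono i -> is_cokernel q i -> is_kernel i q.
Proof.
move=> im qi; have [Z [g ig]] := mono_normal im.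
have [h hq] := cokernel_lift qi (proj1 ig).
apply: kernelI => // [|W f qf0]; first exact: (proj1 qi).
by apply: (kernel_lift ig); rewrite -hq -compA qf0 compm0.
Qed.

Lemma epi_cokernel_kernel K X Y (k : hom K X) (p : hom X Y) :
  epi p -> is_kernel k p -> is_cokernel p k.
Proof.
move=> pe kp; have [Z [g pg]] := epi_conormal pe.
have [h kh] := kernel_lift kp (proj1 pg).
split=> [|W f fk0]; first exact: (proj1 kp).
have [|u up] := cokernel_lift (g := f) pg.
  by rewrite -kh compA fk0 comp0m.
by exists u; split=> // u' u'p; apply: pe; rewrite up.
Qed.

Lemma mono_exact X Y (i : hom X Y) :
  mono i -> exists Q (q : hom Y Q), short_exact i q.
Proof.
move=> im; have [Q [q qi]] := has_cokernels i.
by exists Q, q; split=> //; apply: mono_kernel_cokernel.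
Qed.

Lemma epi_exact X Y (p : hom X Y) :
  epi p -> exists K (k : hom K X), short_exact k p.
Proof.
move=> pe; have [K [k kp]] := has_kernels p.
by exists K, k; split=> //; apply: epi_cokernel_kernel.
Qed.

Lemma short_exact_mono X Y Z (i : hom X Y) (p : hom Y Z) :
  short_exact i p -> mono i.
Proof. by move=> [/kernel_mono]. Qed.

Lemma short_exact_epi X Y Z (i : hom X Y) (p : hom Y Z) :
  short_exact i p -> epi p.
Proof. by move=> [_ /cokernel_epi]. Qed.

(** With [c] the kernel of the cokernel of [f], the point is that [e] is epi:
    if [g \oc e = 0], then [f] factors through [c \oc k], where [k] is the
    kernel of [g]. This monomorphism is itself a kernel, so it contains [c];
    hence [k] has a section and [g = 0]. *)
Lemma image_factorization X Y (f : hom X Y) :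
  exists I (e : hom X I) (c : hom I Y), [/\ epi e, mono c & f = c \oc e].
Proof.
have [Q [q qf]] := has_cokernels f; have [I [c cq]] := has_kernels q.
have [e ce] := kernel_lift cq (proj1 qf).
have cm := kernel_mono cq.
exists I, e, c; split=> //; apply/epiP=> Z g ge0.
have [K [k kg]] := has_kernels g; have [e' ke'] := kernel_lift kg ge0.
have [V [h ckh]] := mono_normal (mono_comp cm (kernel_mono kg)).
have [|h' h'q] := cokernel_lift (g := h) qf.
  by rewrite -ce -ke' !compA -(compA h) (proj1 ckh) comp0m.
have [|s cks] := kernel_lift (g := c) ckh.
  by rewrite -h'q -compA (proj1 cq) compm0.
have ks : k \oc s = idm I by apply: cm; rewrite compA cks compm1.
by rewrite -[g]compm1 -ks compA (proj1 kg) comp0m.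
Qed.

Lemma zero_mono_exists X : exists Z (i : hom Z X), is_zero Z /\ mono i.
Proof.
have [Z zZ] := has_zero A; exists Z, 0; split=> //.
by move=> W g h _; rewrite (proj2 (zZ W) g) (proj2 (zZ W) h).
Qed.

Lemma short_exact_iso X Y Z (i : hom X Y) (p : hom Y Z) :
  short_exact i p -> is_zero Z -> is_iso i.
Proof.
move=> ip zZ; have [|h ih] := kernel_lift (g := idm Y) (proj1 ip).
  exact: (proj2 (zZ Y)).
exists h; split=> //; apply: (short_exact_mono ip).
by rewrite compA ih comp1m compm1.
Qed.

Lemma iso_mono X Y (f : hom X Y) : is_iso f -> mono f.
Proof.
move=> [g [gf _]] W h k fhk.
by rewrite -[h]comp1m -[k]comp1m -gf -!compA fhk.
Qed.

Lemma iso_exact X Y Z (f : hom X Y) :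
  is_iso f -> is_zero Z -> short_exact f (0 : hom Y Z).
Proof.
move=> f_iso zZ; have fm := iso_mono f_iso; case: f_iso => g [gf fg].
split; first apply: kernelI => //; first exact: comp0m.
  by move=> W h _; exists (g \oc h); rewrite compA fg comp1m.
split=> [|V h hf0]; first exact: comp0m.
exists 0; split=> [|h' _]; last by rewrite (proj1 (zZ V) h').
by rewrite comp0m -[h]compm1 -fg compA hf0 comp0m.
Qed.

(** This is a form of the second isomorphism theorem: [Z] is the
    sum [X + Y] inside [M], and [Q = (X + Y) / Y] is a quotient of [X], which
    vanishes only if [X] is contained in [Y]. *)
Lemma subobject_sum X Y M (a : hom X M) (b : hom Y M) : mono b ->
  exists Z (c : hom Z M) (b' : hom Y Z) Q (q : hom Z Q) (p : hom X Q),
    [/\ mono c, c \oc b' = b, short_exact b' q, epi p &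
        is_zero Q -> exists h, b \oc h = a].
Proof.
move=> bm; have [P [i [j [r [s [ri sj si0 rj0 ijP]]]]]] := has_biproducts X Y.
have [Z [e [c [ee cm abE]]]] := image_factorization (a \oc r + b \oc s).
have ceiE : c \oc (e \oc i) = a.
  by rewrite compA -abE compDl -!compA ri si0 compm1 compm0 addr0.
have cejE : c \oc (e \oc j) = b.
  by rewrite compA -abE compDl -!compA sj rj0 compm1 compm0 add0r.
have ejm : mono (e \oc j) by apply: (@mono_compr _ _ _ c); rewrite cejE.
have [Q [q ejq]] := mono_exact ejm.
exists Z, c, (e \oc j), Q, q, (q \oc (e \oc i)); split=> //.
  apply/epiP=> V g gei0; apply/(epiP q).1; first exact: short_exact_epi ejq.
  apply/(epiP e).1 => //.
  rewrite -[g \oc q \oc e]compm1 -ijP compDr !compA.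
  move: gei0; rewrite !compA => ->; rewrite comp0m add0r.
  rewrite -(compA _ e j) -(compA g q) (proj1 (proj1 ejq)).
  by rewrite compm0 comp0m.
move=> zQ; have [h [_ ejh]] := short_exact_iso ejq zQ.
by exists (h \oc (e \oc i)); rewrite -cejE compA -(compA c) ejh compm1 ceiE.
Qed.

(** [Z] is the preimage of [L] under [p]. *)
Lemma subobject_preimage Y X Q L (y : hom Y X) (p : hom X Q) (i : hom L Q) :
  short_exact y p -> mono i ->
  exists N (r : hom Q N) Z (z : hom Z X) (y' : hom Y Z),
    [/\ short_exact i r, short_exact z (r \oc p) & z \oc y' = y].
Proof.
move=> yp im; have [N [r ir]] := mono_exact im.
have [Z [z zrp]] := epi_exact
  (epi_comp (short_exact_epi ir) (short_exact_epi yp)).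
have [|y' zy'] := kernel_lift (g := y) (proj1 zrp).
  by rewrite -compA (proj1 (proj1 yp)) compm0.
by exists N, r, Z, z, y'.
Qed.

Lemma largest_subobject_iso C M L L' (i : hom L M) (i' : hom L' M) :
  is_largest_subobject C i -> is_largest_subobject C i' ->
  exists2 f : hom L' L, is_iso f & i \oc f = i'.
Proof.
move=> [im CL maxi] [i'm CL' maxi'].
have [f iff] := maxi _ _ i'm CL'; have [g ig] := maxi' _ _ im CL.
exists f => //; exists g; split.
  by apply: i'm; rewrite compA ig iff compm1.
by apply: im; rewrite compA iff ig compm1.
Qed.

End AbelianCategory.

(** * Classes and lengths *)

Section ClassMap.
Variables (R : realType) (A : abelian) (n : nat) (cl : A -> 'rV[R]_n).
Hypothesis cl_additive : exact_additive cl.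
Implicit Types X Y Z W K L M N Q : A.

Lemma class_zero Z : is_zero Z -> cl Z = 0.
Proof.
move=> zZ; have id_iso : is_iso (idm Z) by exists (idm Z); rewrite comp1m.
have := cl_additive (iso_exact id_iso zZ).
by rewrite -{1}[cl Z]addr0 => /addrI.
Qed.

Lemma class_isomorphic X Y : isomorphic X Y -> cl X = cl Y.
Proof.
move=> [f f_iso]; have [Z zZ] := has_zero A.
by rewrite (cl_additive (iso_exact f_iso zZ)) (class_zero zZ) addr0.
Qed.

Section SimpleClasses.
Variable S : 'I_n -> A.
Hypotheses (hA : length_category A) (hS : simple_representatives S).
Hypothesis clS : forall i, cl (S i) = delta_mx 0 i.

Lemma simple_class X :
  simple_in (@all_objects A) X -> exists i, cl X = delta_mx 0 i.
Proof.
by move=> /(let: And3 _ _ h := hS in h)[i /class_isomorphic ->]; exists i.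
Qed.

Lemma class_nat X j : cl X 0 j \is a Num.nat.
Proof.
have [l] := hA X; elim=> {X l} [X _ /class_zero X0|X Y T i p l _ ip sT _ IH].
  by rewrite X0 mxE rpred0.
have [k clT] := simple_class sT.
by rewrite (cl_additive ip) clT !mxE rpredD // natr_nat.
Qed.

Lemma class_eq0 X : cl X = 0 -> is_zero X.
Proof.
have [l cX] := hA X; case: cX => // {}X Y T i p {}l _ ip sT _ clX.
have [k clT] := simple_class sT.
have := congr1 (fun v : 'rV_n => v 0 k) (cl_additive ip).
rewrite clX clT !mxE !eqxx /= => /eqP; rewrite eq_sym gt_eqF //.
by rewrite ltr_wpDl ?ltr01 // natr_ge0 // class_nat.
Qed.

End SimpleClasses.

Hypothesis cl_nat : forall X j, cl X 0 j \is a Num.nat.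
Hypothesis cl_eq0 : forall X, cl X = 0 -> is_zero X.

(** By additivity this is the length of any composition series of [X]. *)
Definition length X : nat := (\sum_j Num.trunc (cl X 0%R j))%N.

Lemma length_exact X Y Z (i : hom X Y) (p : hom Y Z) :
  short_exact i p -> length Y = (length X + length Z)%N.
Proof.
move=> ip; rewrite /length -big_split /=; apply: eq_bigr => j _.
by rewrite (cl_additive ip) mxE truncnD // ?nnegrE ?natr_ge0.
Qed.

Lemma length_eq0 X : length X = 0%N -> is_zero X.
Proof.
move=> /eqP; rewrite sum_nat_eq0 => /forallP X0; apply: cl_eq0.
apply/rowP=> j; rewrite mxE -[LHS]truncnK //.
by move: (X0 j); rewrite implyTb => /eqP ->.
Qed.

Lemma length_zero X : is_zero X -> length X = 0%N.
Proof.
move=> /class_zero X0; rewrite /length big1 // => j _.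
by rewrite X0 mxE truncn0.
Qed.

Lemma length_mono X Y (i : hom X Y) : mono i -> (length X <= length Y)%N.
Proof. by move=> /mono_exact[Q [q /length_exact->]]; rewrite leq_addr. Qed.

Lemma mono_iso X Y (i : hom X Y) :
  mono i -> (length Y <= length X)%N -> is_iso i.
Proof.
move=> /mono_exact[Q [q iq]]; rewrite (length_exact iq) -[leqRHS]addn0.
rewrite leq_add2l leqn0 => /eqP/length_eq0; exact: short_exact_iso iq.
Qed.

Definition subobject_classes M : set 'rV[R]_n :=
  [set v | exists X (i : hom X M), mono i /\ v = cl X].

(** Coordinates of classes of subobjects of [M] are natural numbers bounded by
    those of [cl M]. *)
Lemma subobject_classes_finite M :
  exists s : seq 'rV[R]_n, subobject_classes M = [set` s].
Proof.
pose B := length M.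
pose v (f : {ffun 'I_n -> 'I_B.+1}) : 'rV[R]_n := \row_j (f j : nat)%:R.
exists [seq x <- [seq v f | f in {: {ffun 'I_n -> 'I_B.+1}}] |
         `[< subobject_classes M x >]].
apply/seteqP; split=> x /=; rewrite mem_filter; last by case/andP=> /asboolP.
move=> Mx; apply/andP; split; first exact/asboolP.
have [X [i [/length_mono leXM ->]]] := Mx.
apply/mapP; exists [ffun j => inord (Num.trunc (cl X 0 j))].
  by rewrite mem_enum.
apply/rowP=> j; rewrite mxE ffunE inordK ?truncnK // ltnS.
by apply: leq_trans leXM; rewrite /length (bigD1 j) //= leq_addr.
Qed.

(** * Semistable objects *)

Lemma weightD theta X Y Z :
  cl Y = cl X + cl Z -> weight cl theta Y = weight cl theta X + weight cl theta Z.
Proof. by move=> e; rewrite /weight /pairing e mulmxDl mxE. Qed.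

Section Weight.
Variable theta : 'cV[R]_n.

Lemma weight_exact X Y Z (i : hom X Y) (p : hom Y Z) :
  short_exact i p -> weight cl theta Y = weight cl theta X + weight cl theta Z.
Proof. by move=> /cl_additive/(weightD theta). Qed.

Lemma weight_zero X : is_zero X -> weight cl theta X = 0.
Proof. by move=> /class_zero e; rewrite /weight /pairing e mul0mx mxE. Qed.

Lemma weight_isomorphic X Y :
  isomorphic X Y -> weight cl theta X = weight cl theta Y.
Proof. by rewrite /weight => /class_isomorphic ->. Qed.

Lemma Wide_weight X : Wide cl theta X -> weight cl theta X = 0.
Proof.
move=> [TX FX]; apply/eqP; rewrite eq_le.
by rewrite (FX _ _ (@mono_id _ X)) (TX _ _ (@epi_id _ X)).
Qed.

Lemma Wide_zero X : is_zero X -> Wide cl theta X.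
Proof.
move=> zX; split=> [N p pe | L i im].
  rewrite weight_zero //; have [K [k kp]] := epi_exact pe.
  have := length_exact kp; rewrite (length_zero zX) => /eqP.
  by rewrite eq_sym addn_eq0 => /andP[_ /eqP/length_eq0].
rewrite weight_zero //; have := length_mono im; rewrite (length_zero zX).
by rewrite leqn0 => /eqP/length_eq0.
Qed.

(** If [K] is the kernel of a quotient [N] of [Y], then [N] has weight opposite
    to that of [K], which is a subobject of [X]. *)
Lemma Wide_sub X Y (i : hom Y X) :
  Wide cl theta X -> mono i -> weight cl theta Y = 0 -> Wide cl theta Y.
Proof.
move=> [_ FX] im Y0; split=> [N p /epi_exact[K [k kp]] | L j jm].
  have := FX _ _ (mono_comp im (short_exact_mono kp)).
  by have := weight_exact kp; rewrite Y0 => /esym/eqP; rewrite addrC addr_eq0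
    => /eqP ->; rewrite oppr_ge0.
exact: FX (mono_comp im jm).
Qed.

Lemma Wide_quotient X Y (p : hom X Y) :
  Wide cl theta X -> epi p -> weight cl theta Y = 0 -> Wide cl theta Y.
Proof.
move=> [TX _] pe Y0; split=> [N q qe | L i /mono_exact[N [q iq]]].
  exact: TX (epi_comp qe pe).
have := TX _ _ (epi_comp (short_exact_epi iq) pe).
have := weight_exact iq; rewrite Y0 => /esym/eqP; rewrite addr_eq0
  => /eqP ->; by rewrite oppr_le0.
Qed.

(** [V'] is a proper semistable subobject of [W] above [V] of greatest length.
    A semistable subobject of [W / V'] has a semistable preimage in [W], so it
    is zero or everything. *)
Lemma simple_Wide_quotient V W (v : hom V W) :
  Wide cl theta W -> mono v -> Wide cl theta V -> (length V < length W)%N ->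
  exists V' T (i : hom V' W) (p : hom W T) (v' : hom V V'),
    [/\ short_exact i p, Wide cl theta V', simple_in (Wide cl theta) T,
        i \oc v' = v & (length V' < length W)%N].
Proof.
move=> WW vm WV ltVW.
pose P k := exists V' (i : hom V' W) (v' : hom V V'),
  [/\ mono i, i \oc v' = v, Wide cl theta V', length V' = k & (k < length W)%N].
have exP : exists k, `[< P k >].
  by exists (length V); apply/asboolP; exists V, v, (idm V); rewrite compm1.
have ubP k : `[< P k >] -> (k <= length W)%N.
  by move=> /asboolP[? [? [? [_ _ _ _ /ltnW]]]].
have [k /asboolP[V' [i [v' [im iv' WV' <- ltV'W]]]] max_k] := ex_maxnP exP ubP.
have [T [p ip]] := mono_exact im.
have WT : Wide cl theta T.
  apply: (Wide_quotient WW (short_exact_epi ip)).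
  by have := weight_exact ip; rewrite (Wide_weight WW) (Wide_weight WV') add0r.
exists V', T, i, p, v'; split=> //; split=> // [zT|L l WL lm].
  by move: ltV'W; rewrite (length_exact ip) (length_zero zT) addn0 ltnn.
have [N [r [Z [z [y' [lr zrp zy']]]]]] := subobject_preimage ip lm.
have WZ : Wide cl theta Z.
  apply: (Wide_sub WW (short_exact_mono zrp)).
  have := weight_exact zrp; have := weight_exact lr.
  rewrite (Wide_weight WT) (Wide_weight WL) (Wide_weight WW) add0r => <-.
  by rewrite addr0.
have lenZ : length Z = (length V' + length L)%N.
  have := length_exact zrp; rewrite (length_exact ip) (length_exact lr).
  by rewrite addnA => /addIn.
have [leTL|ltLT] := leqP (length T) (length L).
  by right; apply: mono_iso.
left; apply: length_eq0; apply/eqP; rewrite -leqn0 -(leq_add2l (length V')).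
rewrite addn0 -lenZ; apply: max_k; apply/asboolP.
exists Z, z, (y' \oc v'); split=> //; first exact: short_exact_mono zrp.
  by rewrite compA zy' iv'.
by rewrite lenZ (length_exact ip) ltn_add2l.
Qed.

Lemma simple_Wide_top W : Wide cl theta W -> (0 < length W)%N ->
  exists V T (i : hom V W) (p : hom W T),
    [/\ short_exact i p, Wide cl theta V, simple_in (Wide cl theta) T &
        (length V < length W)%N].
Proof.
move=> WW W_gt0; have [Z [z [zZ zm]]] := zero_mono_exists W.
have [|V [T [i [p [_ [? ? ? _ ?]]]]]] := simple_Wide_quotient WW zm (Wide_zero zZ).
  by rewrite (length_zero zZ).
by exists V, T, i, p.
Qed.

Lemma Wide_composition_series W :
  Wide cl theta W -> exists l, composition_series (Wide cl theta) W l.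
Proof.
have [k] := ubnP (length W); elim: k W => // k IH W; rewrite ltnS => leWk WW.
have [W0|W_gt0] := posnP (length W).
  by exists [::]; constructor=> //; apply: length_eq0.
have [V [T [i [p [ip WV sT ltVW]]]]] := simple_Wide_top WW W_gt0.
have [|l cV] := IH V _ WV; first exact: leq_trans ltVW leWk.
by exists (T :: l); apply: CompositionCons ip sT cV.
Qed.

Lemma composition_factors_cons C X Y T (i : hom Y X) (p : hom X T) :
  C X -> short_exact i p -> simple_in C T ->
  composition_factors C Y `<=` composition_factors C X.
Proof.
move=> CX ip sT U [l1 [U' [l2 [cY UU']]]]; exists (T :: l1), U', l2.
by split=> //; apply: CompositionCons ip sT cY.
Qed.

(** A composition series of [W] can be chosen to pass through [V], so that the
    weight of [V] is a sum of weights of members of the support of [W]. *)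
Lemma weight_Wide_sub (eta : 'cV[R]_n) V W (v : hom V W) :
  Wide cl theta W -> mono v -> Wide cl theta V ->
  (forall T, supp cl theta W T -> weight cl eta T = 0) ->
  weight cl eta V = 0.
Proof.
suff weight0 k : forall V W (v : hom V W), (length W < k)%N ->
    Wide cl theta W -> mono v -> Wide cl theta V ->
    (forall T, supp cl theta W T -> weight cl eta T = 0) ->
    weight cl eta V = 0.
  exact: (weight0 _ _ _ v (ltnSn _)).
elim: k => // k IH {V W v} V W v; rewrite ltnS => leWk WW vm WV suppW.
have [leWV|ltVW] := leqP (length W) (length V); last first.
  have [V' [T [i [p [v' [ip WV' sT iv' ltV'W]]]]]] :=
    simple_Wide_quotient WW vm WV ltVW.
  apply: (IH V V' v') => //; first exact: leq_trans ltV'W leWk.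
    by apply: (@mono_compr _ _ _ _ i); rewrite iv'.
  by move=> U /(composition_factors_cons WW ip sT) /suppW.
have -> : weight cl eta V = weight cl eta W.
  by rewrite /weight (@class_isomorphic V W) //; exists v; apply: mono_iso.
have [W0|W_gt0] := posnP (length W).
  by rewrite /weight class_zero ?/pairing ?mul0mx ?mxE //; apply: length_eq0.
have [V' [T [i [p [ip WV' sT ltV'W]]]]] := simple_Wide_top WW W_gt0.
have [l cV'] := Wide_composition_series WV'.
rewrite (weightD _ (cl_additive ip)).
rewrite (suppW T) ?addr0; last first.
  exists [::], T, l; split; last by exists (idm T), (idm T); rewrite comp1m.
  exact: CompositionCons ip sT cV'.
apply: (IH V' V' (idm V')) => //; first exact: leq_trans ltV'W leWk.
  exact: mono_id.
by move=> U /(composition_factors_cons WW ip sT) /suppW.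
Qed.


(** * Maximizers and torsion subobjects *)

(** By [maximizesP] below, the class of [X] then lies on the face of the Newton
    polytope cut out by [theta]. *)
Definition maximizes M X (i : hom X M) : Prop :=
  mono i /\
  forall Y (j : hom Y M), mono j -> weight cl theta Y <= weight cl theta X.

Lemma maximizes_of_weight M X Y (i : hom X M) (j : hom Y M) :
  maximizes i -> mono j -> weight cl theta Y = weight cl theta X ->
  maximizes j.
Proof. by move=> [_ maxi] jm YX; split=> // Z k /maxi; rewrite YX. Qed.

Lemma maximizes_weight M X Y (i : hom X M) (j : hom Y M) :
  maximizes i -> maximizes j -> weight cl theta X = weight cl theta Y.
Proof.
move=> [im maxi] [jm maxj]; apply/eqP; rewrite eq_le.
by rewrite (maxi _ _ jm) (maxj _ _ im).
Qed.

Lemma maximizes_Tbar M X (i : hom X M) : maximizes i -> Tbar cl theta X.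
Proof.
move=> [im maxi] N p /epi_exact[K [k kp]].
have := maxi _ _ (mono_comp im (short_exact_mono kp)).
by rewrite (weight_exact kp) lerDl.
Qed.

(** The quotient [(X + Y) / Y] of [X] cannot have positive weight, as [Y] is
    maximal. *)
Lemma Tstrict_sub_maximizes M X Y (a : hom X M) (b : hom Y M) :
  Tstrict cl theta X -> maximizes b -> exists h, b \oc h = a.
Proof.
move=> TX [bm maxb].
have [Z [c [b' [Q [q [p [cm cb' b'q pe]]]]]]] := subobject_sum a bm.
apply; have [//|nzQ] := pselect (is_zero Q).
have := maxb _ _ cm; rewrite (weight_exact b'q) gerDl leNgt.
by rewrite (TX _ _ pe nzQ).
Qed.

(** This treats the least and the greatest length of a maximizer together. *)
Lemma extremal_maximizer M (r : rel nat) :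
  (forall P : nat -> Prop, (exists k, P k) -> (forall k, P k -> (k <= length M)%N) ->
     exists2 k, P k & forall k', P k' -> r k' k) ->
  (exists X (i : hom X M), maximizes i) ->
  exists X (i : hom X M), maximizes i /\
    forall Y (j : hom Y M), maximizes j -> r (length Y) (length X).
Proof.
move=> ext [X0 [i0 maxi0]].
have [||k [X [i [maxi <-]]] ext_k] := ext (fun k => exists X (i : hom X M),
  maximizes i /\ length X = k).
- by exists (length X0), X0, i0.
- by move=> _ [X [i [[im _] <-]]]; apply: length_mono im.
by exists X, i; split=> // Y j maxj; apply: ext_k; exists Y, j.
Qed.

Lemma minimal_maximizer M : (exists X (i : hom X M), maximizes i) ->
  exists X (i : hom X M), maximizes i /\
    forall Y (j : hom Y M), maximizes j -> (length X <= length Y)%N.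
Proof.
apply: (extremal_maximizer (r := geq)) => P [k Pk] _.
have exP : exists k, `[< P k >] by exists k; apply/asboolP.
have [m /asboolP Pm min_m] := ex_minnP exP.
by exists m => // j Pj; apply: min_m; apply/asboolP.
Qed.

Lemma maximal_maximizer M : (exists X (i : hom X M), maximizes i) ->
  exists X (i : hom X M), maximizes i /\
    forall Y (j : hom Y M), maximizes j -> (length Y <= length X)%N.
Proof.
apply: (extremal_maximizer (r := leq)) => P [k Pk] ubP.
have exP : exists k, `[< P k >] by exists k; apply/asboolP.
have {}ubP j : `[< P j >] -> (j <= length M)%N by move=> /asboolP/ubP.
have [m /asboolP Pm max_m] := ex_maxnP exP ubP.
by exists m => // j Pj; apply: max_m; apply/asboolP.
Qed.

(** A quotient of [T] of weight zero has a maximizer as kernel, which cannot be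
    shorter than [T]. *)
Lemma minimal_maximizer_largest M T (t : hom T M) : maximizes t ->
  (forall Y (j : hom Y M), maximizes j -> (length T <= length Y)%N) ->
  is_largest_subobject (Tstrict cl theta) t.
Proof.
move=> maxt min_t.
split=> [||L j _ TL]; [exact: (proj1 maxt)| |exact: Tstrict_sub_maximizes].
move=> N p pe nzN; have [K [k kp]] := epi_exact pe.
have ktm := mono_comp (proj1 maxt) (short_exact_mono kp).
rewrite lt_neqAle (maximizes_Tbar maxt pe) andbT.
apply: contra_notN nzN => /eqP N0; apply: length_eq0; apply/eqP.
have /min_t : maximizes (t \oc k).
  by apply: maximizes_of_weight maxt ktm _; rewrite (weight_exact kp) -N0 addr0.
by rewrite (length_exact kp) -[leqRHS]addn0 leq_add2l leqn0.
Qed.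

(** If [L] is in [Tbar], then [(L + T) / T] has nonnegative weight, so [L + T] is
    again a maximizer and cannot be longer than [T]. *)
Lemma maximal_maximizer_largest M T (t : hom T M) : maximizes t ->
  (forall Y (j : hom Y M), maximizes j -> (length Y <= length T)%N) ->
  is_largest_subobject (Tbar cl theta) t.
Proof.
move=> maxt max_t.
split=> [||L j _ TL]; [exact: (proj1 maxt)|exact: maximizes_Tbar maxt|].
have [Z [c [b' [Q [q [p [cm cb' b'q pe]]]]]]] := subobject_sum j (proj1 maxt).
apply; apply: length_eq0; apply/eqP.
have Q0 : weight cl theta Q = 0.
  apply/eqP; rewrite eq_le (TL _ _ pe) andbT.
  by have := (proj2 maxt) _ _ cm; rewrite (weight_exact b'q) gerDl.
have /max_t : maximizes c.
  by apply: maximizes_of_weight maxt cm _; rewrite (weight_exact b'q) Q0 addr0.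
by rewrite (length_exact b'q) -[leqRHS]addn0 leq_add2l leqn0.
Qed.

Lemma largest_Tstrict_maximizes M T (t : hom T M) :
  (exists X (i : hom X M), maximizes i) ->
  is_largest_subobject (Tstrict cl theta) t -> maximizes t.
Proof.
move=> /minimal_maximizer[T' [t' [maxt' min_t']]] lt.
have lt' := minimal_maximizer_largest maxt' min_t'.
have [f f_iso _] := largest_subobject_iso lt' lt.
apply: maximizes_of_weight maxt' _ _; first by case: lt.
by apply: weight_isomorphic; exists f.
Qed.

Lemma largest_Tbar_maximizes M T (t : hom T M) :
  (exists X (i : hom X M), maximizes i) ->
  is_largest_subobject (Tbar cl theta) t -> maximizes t.
Proof.
move=> /maximal_maximizer[T' [t' [maxt' max_t']]] lt.
have lt' := maximal_maximizer_largest maxt' max_t'.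
have [f f_iso _] := largest_subobject_iso lt' lt.
apply: maximizes_of_weight maxt' _ _; first by case: lt.
by apply: weight_isomorphic; exists f.
Qed.

Lemma class_preimage Y X Q L (y : hom Y X) (p : hom X Q) (i : hom L Q) :
  short_exact y p -> mono i ->
  exists Z (z : hom Z X), mono z /\ cl Z = cl Y + cl L.
Proof.
move=> yp im; have [N [r [Z [z [_ [ir zrp _]]]]]] := subobject_preimage yp im.
exists Z, z; split; first exact: short_exact_mono zrp.
apply: (addIr (cl N)); rewrite -(cl_additive zrp) (cl_additive yp).
by rewrite (cl_additive ir) addrA.
Qed.

(** The preimage in [Tb] of a subobject [L] of [W] has weight that of [T] plus
    that of [L], and it is a subobject of [M]. *)
Lemma Wide_subquotient M T Tb W (t : hom T M) (tb : hom Tb M)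
    (u : hom T Tb) (w : hom Tb W) :
  maximizes t -> maximizes tb -> short_exact u w -> Wide cl theta W.
Proof.
move=> maxt maxtb uw; split=> [N p pe|L i im].
  exact: maximizes_Tbar maxtb _ _ (epi_comp pe (short_exact_epi uw)).
have [Z [z [zm clZ]]] := class_preimage uw im.
have := (proj2 maxt) _ _ (mono_comp (proj1 maxtb) zm).
by rewrite (weightD _ clZ) gerDl.
Qed.

End Weight.

(** * TF equivalence *)

Section TwoWeights.
Implicit Types theta eta : 'cV[R]_n.

Lemma weight_isomorphic0 theta X Y :
  isomorphic X Y -> weight cl theta Y = 0 -> weight cl theta X = 0.
Proof. by move=> /(weight_isomorphic theta) ->. Qed.

(** [X] is semistable for [theta] and [eta], and its subobjects of weight zero
    are the same for both. This passes to semistable subobjects and quotients,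
    so that [X] has the same composition series for both. *)
Definition same_Wide theta eta X : Prop :=
  [/\ Wide cl theta X, Wide cl eta X &
      forall L (l : hom L X), mono l ->
        weight cl theta L = 0 <-> weight cl eta L = 0].

Lemma same_Wide_sym theta eta X :
  same_Wide theta eta X -> same_Wide eta theta X.
Proof. by move=> [? ? H]; split=> // L l /H []; split. Qed.

Lemma same_Wide_sub theta eta X Y (i : hom Y X) :
  same_Wide theta eta X -> mono i -> weight cl theta Y = 0 ->
  same_Wide theta eta Y.
Proof.
move=> [WX WX' H] im Y0; have Y0' := (H _ _ im).1 Y0.
split; [exact: Wide_sub WX im Y0|exact: Wide_sub WX' im Y0'|].
by move=> L l lm; apply: H (mono_comp im lm).
Qed.

Lemma same_Wide_quotient theta eta X Y Q (i : hom Y X) (p : hom X Q) :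
  same_Wide theta eta X -> short_exact i p -> weight cl theta Y = 0 ->
  same_Wide theta eta Q.
Proof.
move=> [WX WX' H] ip Y0; have Y0' := (H _ _ (short_exact_mono ip)).1 Y0.
have pe := short_exact_epi ip; split.
- apply: (Wide_quotient WX pe).
  by have := weight_exact theta ip; rewrite (Wide_weight WX) Y0 add0r.
- apply: (Wide_quotient WX' pe).
  by have := weight_exact eta ip; rewrite (Wide_weight WX') Y0' add0r.
move=> L l /(class_preimage ip)[Z [z [/H clZ0 clZ]]].
by move: clZ0; rewrite !(weightD _ clZ) Y0 Y0' !add0r.
Qed.

Lemma same_Wide_simple theta eta T :
  same_Wide theta eta T -> simple_in (Wide cl theta) T ->
  simple_in (Wide cl eta) T.
Proof.
move=> [WT WT' H] [_ nzT sT]; split=> // L i WL im; apply: sT => //.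
by apply: (Wide_sub WT im); apply/(H _ _ im); apply: Wide_weight.
Qed.

Lemma same_Wide_composition_series theta eta X l :
  same_Wide theta eta X -> composition_series (Wide cl theta) X l ->
  composition_series (Wide cl eta) X l.
Proof.
move=> sX cX; elim: cX sX => {X l} [X _ zX [_ WX _]|]; first by constructor.
move=> X Y T i p l WX ip sT cY IH sX.
have Y0 : weight cl theta Y = 0.
  by apply: Wide_weight; case: cY.
apply: (CompositionCons _ ip).
- by case: sX.
- exact: same_Wide_simple (same_Wide_quotient sX ip Y0) sT.
- exact: IH (same_Wide_sub sX (short_exact_mono ip) Y0).
Qed.

Lemma same_Wide_supp theta eta X :
  same_Wide theta eta X -> supp cl theta X = supp cl eta X.
Proof.
suff sub theta' eta' : same_Wide theta' eta' X ->
    supp cl theta' X `<=` supp cl eta' X.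
  by move=> sX; apply/seteqP; split; apply: sub => //; apply: same_Wide_sym.
move=> sX T [l1 [T' [l2 [cX TT']]]]; exists l1, T', l2; split=> //.
exact: same_Wide_composition_series cX.
Qed.

Lemma supp_weight theta W T :
  supp cl theta W T -> weight cl theta T = 0.
Proof.
move=> [l1 [T' [l2 [cW TT']]]]; apply: weight_isomorphic0 TT' _.
elim: l1 W cW => [|U l1 IH] W /=.
  move El: (T' :: l2) => l cW; case: cW El => // X Y U i p l' _ _ [WU _ _] _.
  by case=> -> _; apply: Wide_weight.
move El: (U :: l1 ++ T' :: l2) => l cW; case: cW El => // X Y U' i p l' _ _ _ cY.
by case=> _ El; apply: (IH Y); rewrite El.
Qed.

Variable M : A.
Hypothesis maxM : forall theta, exists X (i : hom X M), maximizes theta i.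

Lemma TF_equiv_sym theta eta : TF_equiv cl M theta eta -> TF_equiv cl M eta theta.
Proof.
move=> [T [Tb [W [t [tb [u [w [[? ?] [? ?] ? ? ?]]]]]]]].
by exists T, Tb, W, t, tb, u, w; split.
Qed.

(** For a maximizer [X] of [theta], the quotient [X / T] is a
    [theta]-semistable subobject [V] of [W], hence filtered by members of the
    support of [W], and these have weight zero for [eta] too. *)
Lemma TF_equiv_maximizes theta eta X (i : hom X M) :
  TF_equiv cl M theta eta -> maximizes theta i -> maximizes eta i.
Proof.
move=> [T [Tb [W [t [tb [u [w [[tl tl'] [tbl tbl'] tbu uw suppE]]]]]]]] maxi.
have im := proj1 maxi.
have maxt := largest_Tstrict_maximizes (maxM theta) tl.
have maxt' := largest_Tstrict_maximizes (maxM eta) tl'.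
have maxtb := largest_Tbar_maximizes (maxM theta) tbl.
have tbm := proj1 maxtb.
have [s ist] := Tstrict_sub_maximizes t (let: And3 _ h _ := tl in h) maxi.
have [x tbx] : exists x, tb \oc x = i.
  by case: tbl => _ _; apply=> //; apply: maximizes_Tbar maxi.
have um : mono u.
  by apply: (@mono_compr _ _ _ _ tb); rewrite tbu; apply: (proj1 maxt).
have ue : short_exact u w by split=> //; apply: mono_kernel_cokernel.
have xs : x \oc s = u by apply: tbm; rewrite compA tbx ist tbu.
have [V [e [c [ee cm ceE]]]] := image_factorization (w \oc x).
have sm : mono s by apply: (@mono_compr _ _ _ _ i); rewrite ist; apply: (proj1 maxt).
(* V is the image of X in W, and T is the kernel of X -> V *)
have se : is_kernel s e.
  apply: kernelI => // [|Y g eg0].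
    apply: cm; rewrite compm0 compA -ceE -compA xs; exact: (proj1 (proj1 ue)).
  have [|h uh] := kernel_lift (g := x \oc g) (proj1 ue).
    by rewrite compA ceE -compA eg0 compm0.
  exists h; apply: im; rewrite compA ist -tbu -compA uh compA tbx //.
have ses : short_exact s e by split=> //; apply: epi_cokernel_kernel.
have V0 : weight cl theta V = 0.
  have := weight_exact theta ses; rewrite (maximizes_weight maxi maxt).
  by rewrite -[LHS]addr0 => /addrI.
have WW := Wide_subquotient maxt maxtb ue.
apply: maximizes_of_weight maxt' im _.
rewrite (weight_exact eta ses) (weight_Wide_sub WW cm (Wide_sub WW cm V0)).
  by rewrite addr0.
by move=> U; rewrite suppE; apply: supp_weight.
Qed.

(** Conversely, if [theta] and [eta] have the same maximizers, then so do the
    extremal ones among them, which are the torsion subobjects, and the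
    subobjects of weight zero of the subquotient [W] agree. *)
Lemma TF_equivP theta eta : TF_equiv cl M theta eta <->
  forall X (i : hom X M), maximizes theta i <-> maximizes eta i.
Proof.
split=> [te X i|H].
  split; apply: TF_equiv_maximizes => //; exact: TF_equiv_sym.
have [T [t [maxt min_t]]] := minimal_maximizer (maxM theta).
have [Tb [tb [maxtb max_tb]]] := maximal_maximizer (maxM theta).
have tl := minimal_maximizer_largest maxt min_t.
have maxt' := (H _ _).1 maxt; have maxtb' := (H _ _).1 maxtb.
have [u tbu] := Tstrict_sub_maximizes t (let: And3 _ h _ := tl in h) maxtb.
have um : mono u.
  by apply: (@mono_compr _ _ _ _ tb); rewrite tbu; apply: (proj1 maxt).
have [W [w uw]] := mono_exact um.
exists T, Tb, W, t, tb, u, w; split=> //; last first.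
- apply: same_Wide_supp; split.
  + exact: Wide_subquotient maxt maxtb uw.
  + exact: Wide_subquotient maxt' maxtb' uw.
  move=> L l /(class_preimage uw)[Z [z [zm clZ]]].
  have tbzm := mono_comp (proj1 maxtb) zm.
  have weightZ th : weight cl th Z = weight cl th T + weight cl th L.
    exact: weightD clZ.
  split=> L0.
    have maxz : maximizes theta (tb \oc z).
      by apply: maximizes_of_weight maxt tbzm _; rewrite weightZ L0 addr0.
    apply: (addrI (weight cl eta T)); rewrite addr0 -weightZ.
    exact: maximizes_weight ((H _ _).1 maxz) maxt'.
  have maxz : maximizes eta (tb \oc z).
    by apply: maximizes_of_weight maxt' tbzm _; rewrite weightZ L0 addr0.
  apply: (addrI (weight cl theta T)); rewrite addr0 -weightZ.
  exact: maximizes_weight ((H _ _).2 maxz) maxt.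
- exact: (proj2 uw).
- split; apply: maximal_maximizer_largest => // Y j /H; exact: max_tb.
split=> //; apply: minimal_maximizer_largest => // Y j /H; exact: min_t.
Qed.

End TwoWeights.
End ClassMap.

(** * Pairing and annihilators *)

Section Pairing.
Variables (R : realType) (n : nat).
Implicit Types (theta eta : 'cV[R]_n) (u v w : 'rV[R]_n).

Lemma pairingDl theta eta v :
  pairing (theta + eta) v = pairing theta v + pairing eta v.
Proof. by rewrite /pairing mulmxDr mxE. Qed.

Lemma pairingZl a theta v : pairing (a *: theta) v = a * pairing theta v.
Proof. by rewrite /pairing -scalemxAr mxE. Qed.

Lemma pairingBr theta v w :
  pairing theta (v - w) = pairing theta v - pairing theta w.
Proof. by rewrite /pairing mulmxBl mxE [in X in _ + X]mxE. Qed.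

Lemma pairing_suml k (a : 'I_k -> R) (t : 'I_k -> 'cV[R]_n) v :
  pairing (\sum_i a i *: t i) v = \sum_i a i * pairing (t i) v.
Proof.
rewrite /pairing mulmx_sumr summxE; apply: eq_bigr => i _.
by rewrite -scalemxAr mxE.
Qed.

Lemma pairing_sumr k (a : 'I_k -> R) (u : 'I_k -> 'rV[R]_n) theta :
  pairing theta (\sum_i a i *: u i) = \sum_i a i * pairing theta (u i).
Proof.
rewrite /pairing mulmx_suml summxE; apply: eq_bigr => i _.
by rewrite -scalemxAl mxE.
Qed.

Lemma pairing_continuous v : continuous (fun theta : 'cV[R]_n => pairing theta v).
Proof.
have -> : (fun theta => pairing theta v) = fun theta => \sum_j v 0 j * theta j 0.
  by apply/funext => theta; rewrite /pairing mxE.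
elim: (index_enum _) => [|j r IH].
  rewrite (_ : (fun _ => _) = fun=> 0); first exact: cst_continuous.
  by apply/funext => theta; rewrite big_nil.
rewrite (_ : (fun _ => _) =
    fun theta => v 0 j * theta j 0 + \sum_(i <- r) v 0 i * theta i 0).
  move=> theta; apply: continuousD (IH theta).
  by apply: continuousM; [exact: cst_continuous|exact: coord_continuous].
by apply/funext => theta; rewrite big_cons.
Qed.

Lemma near_ray theta eta (B : set 'cV[R]_n) :
  nbhs theta B -> exists2 e : R, 0 < e & B (theta + e *: eta).
Proof.
move=> Btheta.
have ray : (fun e : R => theta + e *: eta) @ (0 : R) --> theta + 0 *: eta.
  by apply: cvgD; [exact: cvg_cst|apply: cvgZ; [exact: cvg_id|exact: cvg_cst]].
rewrite scale0r addr0 in ray.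
have near0 : \forall e \near (0 : R)^'+, B (theta + e *: eta).
  by apply: cvg_within; apply: ray.
by have [e [e0 Be]] := filter_ex (filterI (nbhs_right_gt (0 : R)) near0); exists e.
Qed.

(** The annihilator has dimension at least [n - \dim U] as the kernel of a map
    to a space of dimension [\dim U], and at most that because it meets the
    transpose of [U] trivially, the standard inner product being positive
    definite. *)
Lemma annihilator_dim (U : {vspace 'rV[R]_n}) :
  exists U' : {vspace 'cV[R]_n},
    (forall theta, theta \in U' <-> forall u, u \in U -> pairing theta u = 0) /\
    \dim U' = (n - \dim U)%N.
Proof.
pose B : 'M[R]_(\dim U, n) := \matrix_(i < \dim U) (vbasis U)`_i.
pose f := linfun (mulmx B : 'cV[R]_n -> 'cV[R]_(\dim U)).
have BE theta i : (B *m theta) i 0 = pairing theta (vbasis U)`_i.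
  by rewrite /pairing -(rowK (fun i => (vbasis U)`_i) i) -row_mul [RHS]mxE.
have kerP theta :
    theta \in lker f <-> forall u, u \in U -> pairing theta u = 0.
  rewrite memv_ker lfunE /=; split=> [/eqP Bt0 u uU|theta0].
    rewrite (coord_vbasis uU) pairing_sumr big1 // => i _.
    by rewrite -BE Bt0 mxE mulr0.
  apply/eqP/colP => i; rewrite [RHS]mxE BE.
  by rewrite theta0 // vbasis_mem // mem_nth // size_tuple.
exists (lker f); split=> //.
pose tr := linfun (trmx : 'rV[R]_n -> 'cV[R]_n).
have dim_trU : \dim (tr @: U) = \dim U.
  apply: limg_dim_eq; apply/eqP; rewrite -subv0; apply/subvP => u.
  rewrite memv_cap memv_ker lfunE /= => /andP[_ /eqP u0].
  by rewrite -[u]trmxK u0 trmx0 mem0v.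
have disj : (lker f :&: (tr @: U) = 0)%VS.
  apply/eqP; rewrite -subv0; apply/subvP => theta /memv_capP[/kerP theta0].
  move=> /memv_imgP[u uU thetaE]; move: (theta0 u uU).
  rewrite thetaE lfunE /= /pairing mxE => /eqP.
  rewrite psumr_eq0 => [/allP u0|j _]; last by rewrite mxE -expr2 sqr_ge0.
  rewrite memv0; apply/eqP/colP => j; rewrite !mxE.
  move: (u0 j (mem_index_enum _)); rewrite mxE -expr2 sqrf_eq0.
  by move=> /eqP.
apply/eqP; rewrite eqn_leq; apply/andP; split.
  rewrite leq_subRL; last first.
    by apply: leq_trans (dimvS (subvf _)) _; rewrite dimvf /dim /= mul1n.
  have dim_sum := dimv_disjoint_sum disj; rewrite dim_trU in dim_sum.
  rewrite addnC -dim_sum.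
  by apply: leq_trans (dimvS (subvf _)) _; rewrite dimvf /dim /= muln1.
rewrite leq_subLR.
have := limg_ker_dim f fullv; rewrite capfv.
have -> : \dim {: 'cV[R]_n} = n by rewrite dimvf /dim /= muln1.
move=> dim_ker; rewrite -[leqLHS]dim_ker addnC leq_add2r.
by apply: leq_trans (dimvS (subvf _)) _; rewrite dimvf /dim /= muln1.
Qed.

End Pairing.

(** Each generator of the direction space may be scaled separately, since the
    scaling is absorbed by the coefficients of an affine combination. *)
Lemma has_dim_span (R : realType) (V : vectType R) (C : set V) (w0 : V) (X : seq V) :
  C w0 -> (forall v, C v -> v - w0 \in <<X>>%VS) ->
  (forall x, x \in X -> exists2 e, e != 0 & C (w0 + e *: x)) ->
  has_dim C (\dim <<X>>).
Proof.
move=> Cw0 CX XC; exists w0, <<X>>%VS; split=> //; apply/seteqP; split=> x.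
  move=> [k [a [v [Cv a1 ->]]]]; exists (\sum_i a i *: (v i - w0)).
    by apply: rpred_sum => i _; apply: rpredZ; apply: CX.
  under eq_bigr do rewrite scalerBr.
  by rewrite sumrB -scaler_suml a1 scale1r addrC subrK.
move=> [u /= uX <-].
have /choice[e eP] : forall i : 'I_(size X),
    exists b, b != 0 /\ C (w0 + b *: X`_i).
  by move=> i; have [b b0 Cb] := XC X`_i (mem_nth _ (ltn_ord i)); exists b.
pose c i := coord (in_tuple X) i u / e i.
(* the extra point w0 brings the sum of the coefficients to 1 *)
exists (size X).+1.
exists (fun i => if unlift ord0 i is Some j then c j else 1 - \sum_j c j).
exists (fun i => if unlift ord0 i is Some j then w0 + e j *: X`_j else w0).
split.
- by move=> i; case: unliftP => [j _|_ //]; apply: (eP j).2.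
- rewrite big_ord_recl unlift_none; under [X in _ + X]eq_bigr do rewrite liftK.
  by rewrite subrK.
rewrite big_ord_recl unlift_none.
under [X in _ = _ + X]eq_bigr do rewrite !liftK scalerDr scalerA.
rewrite big_split /= -scaler_suml addrA -scalerDl subrK scale1r; congr (_ + _).
rewrite {1}(coord_span (X := in_tuple X) uX); apply: eq_bigr => i _.
by rewrite /c divfK //; case: (eP i).
Qed.

(** * Faces and normal cones of a polytope *)

Section Polytope.
Variables (R : realType) (n : nat) (s : seq 'rV[R]_n).
Hypothesis s_neq0 : exists v, v \in s.
Implicit Types (theta eta : 'cV[R]_n) (u v w : 'rV[R]_n).
Local Notation P := (convex_hull [set` s]).

Lemma mem_convex_hull v : v \in s -> P v.
Proof.
move=> vs; exists 1%N, (fun=> 1), (fun=> v); split=> //.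
  by rewrite big_ord1.
by rewrite big_ord1 scale1r.
Qed.

Lemma convex_hull_le theta m :
  (forall v, v \in s -> pairing theta v <= m) ->
  forall v, P v -> pairing theta v <= m.
Proof.
move=> le_m _ [k [a [v [sv a_ge0 a1 ->]]]].
rewrite pairing_sumr -[m]mul1r -a1 mulr_suml; apply: ler_sum => i _.
by rewrite ler_wpM2l // le_m //; apply: sv.
Qed.

Lemma max_faceE theta v w :
  max_face P theta v -> max_face P theta w -> pairing theta v = pairing theta w.
Proof.
by move=> [Pv maxv] [Pw maxw]; apply/eqP; rewrite eq_le maxv // maxw.
Qed.

Lemma max_faceP theta v : v \in s ->
  max_face P theta v <-> forall w, w \in s -> pairing theta w <= pairing theta v.
Proof.
move=> vs; split=> [[_ maxv] w /mem_convex_hull/maxv //|maxv].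
by split; [exact: mem_convex_hull|exact: convex_hull_le].
Qed.

Lemma max_face_generator theta : exists2 v, v \in s & max_face P theta v.
Proof.
suff [v vs maxv] : exists2 v, v \in s &
    forall w, w \in s -> pairing theta w <= pairing theta v.
  by exists v => //; apply/max_faceP.
have [v0] := s_neq0; elim: s v0 => // v [|w r] IH _ _.
  by exists v; rewrite ?mem_head // => w; rewrite inE => /eqP ->.
have [w' w'r maxw'] := IH w (mem_head _ _).
have [le_vw'|lt_w'v] := leP (pairing theta v) (pairing theta w').
  exists w'; first by rewrite inE w'r orbT.
  by move=> x; rewrite inE => /orP[/eqP ->|/maxw'].
exists v; first exact: mem_head.
move=> x; rewrite inE => /orP[/eqP -> //|/maxw' le_x].
exact: le_trans le_x (ltW lt_w'v).
Qed.

(** In a convex combination of maximal weight, the terms of nonzero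
    coefficient have maximal weight. *)
Lemma max_face_hull theta :
  max_face P theta = convex_hull [set v | v \in s /\ max_face P theta v].
Proof.
have [w0 w0s maxw0] := max_face_generator theta.
apply/seteqP; split=> [x maxx|x [k [a [v [vP a_ge0 a1 ->]]]]].
  have [[k [a [v [sv a_ge0 a1 xE]]]] _] := maxx.
  exists k, a, (fun i => if a i == 0 then w0 else v i); split=> //; last first.
    by rewrite xE; apply: eq_bigr => i _; case: eqP => // ->; rewrite !scale0r.
  move=> i /=; case: eqVneq => // ai0.
  split; first exact: sv.
  have defect : \sum_i a i * (pairing theta w0 - pairing theta (v i)) = 0.
    under eq_bigr do rewrite mulrBr.
    rewrite sumrB -mulr_suml a1 mul1r -pairing_sumr -xE.
    by rewrite (max_faceE maxw0 maxx) subrr.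
  have defect_ge0 j : true -> 0 <= a j * (pairing theta w0 - pairing theta (v j)).
    move=> _; rewrite mulr_ge0 // subr_ge0 (proj2 maxw0) //.
    by apply: mem_convex_hull; apply: sv.
  have /eqP := psumr_eq0P defect_ge0 defect (i := i) isT.
  rewrite mulf_eq0 (negPf ai0) /= subr_eq0 => /eqP w0vi.
  apply/max_faceP; first exact: sv.
  by move=> w ws; rewrite -w0vi; apply: (proj2 maxw0); apply: mem_convex_hull.
split.
  by exists k, a, v; split=> // i; case: (vP i).
move=> w Pw; rewrite pairing_sumr.
have -> : \sum_i a i * pairing theta (v i) = pairing theta w0.
  rewrite -[RHS]mul1r -a1 mulr_suml; apply: eq_bigr => i _; congr (_ * _).
  by apply: max_faceE => //; case: (vP i).
exact: (proj2 maxw0).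
Qed.

Lemma max_face_eq theta eta :
  (forall v, v \in s -> max_face P theta v <-> max_face P eta v) ->
  max_face P theta = max_face P eta.
Proof.
move=> H; rewrite (max_face_hull theta) (max_face_hull eta); congr convex_hull.
by apply/seteqP; split=> v [vs /H]; split=> //; tauto.
Qed.

(** At a common maximal point the sum attains the sum of the two maxima, and it
    is as large elsewhere only where neither term is smaller. *)
Lemma max_face_ray theta eta (e : R) : 0 < e ->
  max_face P theta `&` max_face P eta !=set0 ->
  max_face P (theta + e *: eta) = max_face P theta `&` max_face P eta.
Proof.
move=> e0 [w0 [maxw0 maxw0']]; apply/seteqP; split=> v; last first.
  move=> [[Pv maxv] [_ maxv']]; split=> // w Pw.
  by rewrite !pairingDl !pairingZl lerD ?maxv // ler_wpM2l ?maxv' // ltW.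
move=> [Pv maxv]; have := maxv _ (proj1 maxw0).
rewrite !pairingDl !pairingZl => le_w0v.
have lev := (proj2 maxw0) _ Pv; have lev' := (proj2 maxw0') _ Pv.
have Ev : pairing theta v = pairing theta w0.
  apply/eqP; rewrite eq_le lev /=.
  have : e * pairing eta v <= e * pairing eta w0 by rewrite ler_wpM2l // ltW.
  by move=> h; have := le_trans le_w0v (lerD (lexx _) h); rewrite lerD2r.
have Ev' : pairing eta v = pairing eta w0.
  apply/eqP; rewrite eq_le lev' /=.
  by move: le_w0v; rewrite Ev lerD2l ler_pM2l.
split; split=> // w Pw; rewrite ?Ev ?Ev'; [exact: (proj2 maxw0)|].
exact: (proj2 maxw0').
Qed.

Local Notation F theta := (max_face P theta).
Local Notation sigma theta := (normal_cone P (F theta)).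

Lemma normal_cone_const theta eta v w :
  sigma theta eta -> F theta v -> F theta w -> pairing eta v = pairing eta w.
Proof. by move=> H /H Fv /H Fw; apply: max_faceE. Qed.

Lemma normal_coneI theta eta w0 : F theta w0 ->
  (forall v, v \in s -> F theta v -> pairing eta v = pairing eta w0) ->
  (forall v, v \in s -> pairing eta v <= pairing eta w0) ->
  sigma theta eta.
Proof.
move=> Fw0 constF maxw0 v Fv; split; first exact: (proj1 Fv).
have -> : pairing eta v = pairing eta w0.
  move: Fv; rewrite max_face_hull => -[k [a [u [uP a_ge0 a1 ->]]]].
  rewrite pairing_sumr -[RHS]mul1r -a1 mulr_suml; apply: eq_bigr => i _.
  by case: (uP i) => us Fu; rewrite constF.
exact: convex_hull_le.
Qed.

(** Given that [eta] is constant on the face, only the finitely many points of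
    [s] outside the face impose a condition, and each of them an open one. *)
Lemma near_normal_cone theta w0 : F theta w0 ->
  \forall eta \near theta,
    (forall v, v \in s -> F theta v -> pairing eta v = pairing eta w0) ->
    sigma theta eta.
Proof.
move=> Fw0.
suff : \forall eta \near theta, forall v, v \in s ->
    ~ F theta v -> pairing eta v < pairing eta w0.
  apply: filterS => eta lt_eta constF; apply: (normal_coneI Fw0 constF).
  move=> v vs; have [Fv|nFv] := pselect (F theta v); first by rewrite constF.
  exact/ltW/lt_eta.
have lt_theta v : v \in s -> ~ F theta v -> pairing theta v < pairing theta w0.
  move=> vs nFv; rewrite lt_neqAle (proj2 Fw0) ?andbT; last first.
    exact: mem_convex_hull.
  apply: contra_notN nFv => /eqP Ev; split; first exact: mem_convex_hull.
  by rewrite Ev; apply: (proj2 Fw0).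
suff near_lt (r : seq 'rV[R]_n) :
    (forall v, v \in r -> ~ F theta v -> pairing theta v < pairing theta w0) ->
    \forall eta \near theta, forall v, v \in r ->
      ~ F theta v -> pairing eta v < pairing eta w0.
  exact: near_lt.
elim: r => [_|v r IH {}lt_theta]; first by apply: filterE.
have {}IH := IH (fun w wr => lt_theta w (mem_behead (s := v :: r) wr)).
have [Fv|nFv] := pselect (F theta v).
  apply: filterS IH => eta lt_eta w.
  by rewrite inE => /orP[/eqP -> //|/lt_eta].
have near_v : \forall eta \near theta, pairing eta v < pairing eta w0.
  have lt_v := lt_theta v (mem_head _ _) nFv.
  have : \forall eta \near theta, 0 < pairing eta (w0 - v).
    apply: (cvgr_gt _ (@pairing_continuous R n (w0 - v) theta)).
    by rewrite pairingBr subr_gt0.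
  by apply: filterS => eta; rewrite pairingBr subr_gt0.
apply: filterS2 near_v IH => eta lt_eta_v lt_eta w.
by rewrite inE => /orP[/eqP -> //|/lt_eta].
Qed.

(** Every [eta] in the cone is the limit, as [e > 0] tends to zero, of
    functionals [eta + e theta] cutting out the same face as [theta]; and
    membership in the cone is a closed condition. *)
Lemma closure_face_class theta :
  closure [set eta | F eta = F theta] = sigma theta.
Proof.
have [w0 w0s Fw0] := max_face_generator theta; apply/seteqP; split=> eta.
  move=> cl_eta v Fv; split; first exact: (proj1 Fv).
  move=> w Pw; rewrite leNgt; apply/negP => lt_vw.
  have near_eta : \forall zeta \near eta, 0 < pairing zeta (w - v).
    apply: (cvgr_gt _ (@pairing_continuous R n (w - v) eta)).
    by rewrite pairingBr subr_gt0.
  have [zeta [/= Fzeta]] := cl_eta _ near_eta.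
  move: Fv; rewrite -Fzeta => -[_ /(_ _ Pw)].
  by rewrite pairingBr subr_gt0 leNgt => /negPf ->.
move=> sig_eta B /(near_ray theta)[e e0 Be]; exists (eta + e *: theta); split=> //=.
rewrite max_face_ray //; last by exists w0; split=> //; apply: sig_eta.
by apply/seteqP; split=> [v []//|v Fv]; split=> //; apply: sig_eta.
Qed.

Lemma cone_relint_self theta : cone_relint (sigma theta) theta.
Proof.
have [w0 w0s Fw0] := max_face_generator theta; split; first by move=> v.
apply: filterS (near_normal_cone Fw0) => eta H [k [a [t [sig_t etaE]]]].
apply: H => v vs Fv; rewrite etaE !pairing_suml; apply: eq_bigr => i _.
by rewrite (normal_cone_const (sig_t i) Fv Fw0).
Qed.

(** A functional [eta] in the relative interior remains in the cone when pushed
    slightly away from [theta]. At a point where [eta] is maximal but [theta]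
    is not, this push would give a value greater than on the face. *)
Lemma max_face_relint theta eta :
  cone_relint (sigma theta) eta -> F eta = F theta.
Proof.
have [w0 w0s Fw0] := max_face_generator theta.
move=> [sig_eta near_eta]; apply/seteqP; split=> [v Fv|]; last exact: sig_eta.
have [e e0 Be] := near_ray (eta - theta) near_eta.
have {Be} sig_e : sigma theta (eta + e *: (eta - theta)).
  apply: Be; exists 2%N, (fun i => if i == ord0 then 1 + e else - e).
  exists (fun i => if i == ord0 then eta else theta); split.
    by move=> i; case: ifP => // _ w.
  by rewrite big_ord_recl big_ord1 /= scalerBr scalerDl scale1r scaleNr addrA.
have := (proj2 (sig_e _ Fw0)) _ (proj1 Fv).
have Ev := max_faceE Fv (sig_eta _ Fw0).
rewrite !pairingDl !pairingZl Ev lerD2l ler_pM2l // -scaleN1r !pairingDl.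
rewrite !pairingZl Ev lerD2l !mulN1r lerN2 => le_w0v.
split; first exact: (proj1 Fv).
by move=> w Pw; apply: le_trans le_w0v; apply: (proj2 Fw0).
Qed.

(** The cone spans the annihilator of the directions of the face, as [theta]
    plus any small element of that annihilator stays in the cone. *)
Lemma face_cone_dim theta : exists d,
  [/\ has_dim (F theta) d, has_dim (sigma theta) (n - d)%N & (d <= n)%N].
Proof.
have [w0 w0s Fw0] := max_face_generator theta.
pose X := [seq v - w0 | v <- s & `[< F theta v >]].
have [U' [U'P dimU']] := annihilator_dim <<X>>.
have FX v : v \in s -> F theta v -> v - w0 \in <<X>>%VS.
  move=> vs Fv; apply: memv_span; apply/mapP; exists v => //.
  by rewrite mem_filter vs andbT; apply/asboolP.
have XF x : x \in X -> F theta (w0 + x).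
  move=> /mapP[v]; rewrite mem_filter => /andP[/asboolP Fv _] ->.
  by rewrite addrC subrK.
exists (\dim <<X>>); split.
- apply: has_dim_span Fw0 _ _ => [v|x /XF Fx]; last first.
    by exists 1; rewrite ?oner_neq0 // scale1r.
  rewrite max_face_hull => -[k [a [u [uP a_ge0 a1 ->]]]].
  rewrite -[w0]scale1r -a1 scaler_suml -sumrB; apply: rpred_sum => i _.
  by rewrite -scalerBr; apply: rpredZ; case: (uP i) => us Fu; apply: FX.
- rewrite -dimU' -(span_basis (vbasisP U')).
  apply: (@has_dim_span _ _ _ theta) => [v //|eta sig_eta|eta etaX].
    rewrite (span_basis (vbasisP U')); apply/U'P => u.
    move=> /(coord_span (X := in_tuple X)) ->; rewrite pairing_sumr big1 // => i _.
    have Fi : F theta (w0 + X`_i) by apply: XF; apply: mem_nth.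
    have -> : X`_i = (w0 + X`_i) - w0 by rewrite addrC addKr.
    rewrite !(pairingBr, pairingDl) -scaleN1r !pairingZl.
    rewrite (normal_cone_const sig_eta Fi Fw0) (max_faceE Fi Fw0).
    by rewrite !subrr mulr0.
  have {etaX} /U'P eta0 : eta \in U' by apply: vbasis_mem.
  have [e e0 Be] := near_ray eta (near_normal_cone Fw0).
  exists e; first by rewrite gt_eqF.
  apply: Be => v vs Fv; rewrite !pairingDl !pairingZl (max_faceE Fv Fw0).
  congr (_ + _ * _); apply/eqP; rewrite -subr_eq0 -pairingBr.
  by apply/eqP/eta0/FX.
by apply: leq_trans (dimvS (subvf _)) _; rewrite dimvf /dim /= mul1n.
Qed.

End Polytope.

(** * The Newton polytope *)

Section NewtonPolytope.
Variables (R : realType) (A : abelian) (n : nat) (cl : A -> 'rV[R]_n) (M : A).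
Variable s : seq 'rV[R]_n.
Hypothesis sE : subobject_classes cl M = [set` s].

Lemma newtonE : newton cl M = convex_hull [set` s].
Proof. by rewrite -sE. Qed.

Lemma subobject_classesP v :
  v \in s <-> exists X (i : hom X M), mono i /\ v = cl X.
Proof. by change ([set` s] v <-> subobject_classes cl M v); rewrite sE. Qed.

Lemma subobject_classes_neq0 : exists v, v \in s.
Proof.
by exists (cl M); apply/subobject_classesP; exists M, (idm M); split=> //;
  apply: mono_id.
Qed.

Lemma maximizesP theta X (i : hom X M) : mono i ->
  maximizes cl theta i <-> max_face (convex_hull [set` s]) theta (cl X).
Proof.
move=> im; have Xs : cl X \in s by apply/subobject_classesP; exists X, i.
rewrite max_faceP //; split=> [[_ maxi] w|maxX].
  by move=> /subobject_classesP[Y [j [jm ->]]]; apply: maxi jm.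
by split=> // Y j jm; apply: maxX; apply/subobject_classesP; exists Y, j.
Qed.

Lemma maximizer_exists theta : exists X (i : hom X M), maximizes cl theta i.
Proof.
have [v /subobject_classesP[X [i [im ->]]] maxv] :=
  max_face_generator subobject_classes_neq0 theta.
by exists X, i; apply/maximizesP.
Qed.

Lemma max_face_maximizes theta eta :
  max_face (convex_hull [set` s]) theta = max_face (convex_hull [set` s]) eta
  <-> forall X (i : hom X M), maximizes cl theta i <-> maximizes cl eta i.
Proof.
split=> [E X i|H].
  by split=> maxi; have im := proj1 maxi; apply/(maximizesP _ im);
    [rewrite -E|rewrite E]; apply/(maximizesP _ im).
apply: (max_face_eq subobject_classes_neq0) => v.
by move=> /subobject_classesP[X [i [im ->]]]; rewrite -!(maximizesP _ im).
Qed.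

End NewtonPolytope.

Theorem theorem1p7 (R : realType) (A : abelian) (hA : length_category A)
    (n : nat) (S : 'I_n -> A) (hS : simple_representatives S)
    (cl : A -> 'rV[R]_n) (hcl : is_class_map S cl) (M : A) :
  Sigma cl M = normal_fan (newton cl M) /\
  (exists Psi : set 'cV[R]_n -> set 'rV[R]_n,
     [/\ set_fun (Face (newton cl M)) (Sigma cl M) (normal_cone (newton cl M)),
         set_fun (Sigma cl M) (Face (newton cl M)) Psi,
         (forall F, Face (newton cl M) F ->
            Psi (normal_cone (newton cl M) F) = F) /\
         (forall s, Sigma cl M s ->
            normal_cone (newton cl M) (Psi s) = s),
         (forall F G, Face (newton cl M) F -> Face (newton cl M) G ->
            F `<=` G ->
            normal_cone (newton cl M) G `<=` normal_cone (newton cl M) F) /\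
         (forall s s', Sigma cl M s -> Sigma cl M s' ->
            s `<=` s' -> Psi s' `<=` Psi s) &
         forall s, Sigma cl M s ->
           cone_relint s !=set0 /\
           forall theta, cone_relint s theta ->
             Psi s = max_face (newton cl M) theta]) /\
  (forall F, Face (newton cl M) F ->
     exists d e : nat, [/\ has_dim F d, has_dim (normal_cone (newton cl M) F) e
                         & (d <= n)%N /\ e = (n - d)%N]).
Proof.
have [[cl_add _] clS] := hcl.
have cl_nat := class_nat cl_add hA hS clS.
have cl_eq0 := class_eq0 cl_add hA hS clS.
have [s sE] := subobject_classes_finite cl_add cl_nat M.
have s_neq0 := subobject_classes_neq0 sE.
pose N := newton cl M; have NE : N = convex_hull [set` s] := newtonE sE.
rewrite -/N.
have TF_class theta : [set eta | TF_equiv cl M theta eta] =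
    [set eta | max_face N eta = max_face N theta].
  apply/seteqP; split=> eta /=; rewrite NE
    (TF_equivP cl_add cl_nat cl_eq0 (maximizer_exists sE));
    rewrite -(max_face_maximizes sE) => ->; exact: erefl.
have SigmaE : Sigma cl M = [set normal_cone N (max_face N theta) | theta in setT].
  apply/seteqP; split=> C.
    move=> [_ [theta _ <-] <-]; exists theta => //.
    by rewrite TF_class NE closure_face_class.
  move=> [theta _ <-]; exists [set eta | TF_equiv cl M theta eta].
    by exists theta.
  by rewrite TF_class NE closure_face_class.
have faceP theta : Face N (max_face N theta).
  split; last by exists theta.
  by rewrite NE; have [v _ Fv] := max_face_generator s_neq0 theta; exists v.
have psiE theta :
    \bigcap_(eta in normal_cone N (max_face N theta)) max_face N eta =
    max_face N theta.
  apply/seteqP; split=> [v Fv|v Fv eta]; last exact.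
  by apply: Fv => w.
split.
  rewrite SigmaE; apply/seteqP; split=> C.
    by move=> [theta _ <-]; exists (max_face N theta).
  by move=> [F [_ [theta ->]] <-]; exists theta.
split.
  exists (fun C => \bigcap_(eta in C) max_face N eta); rewrite SigmaE; split.
  - by move=> F [_ [theta ->]]; exists theta.
  - by move=> _ [theta _ <-]; rewrite psiE.
  - split; first by move=> F [_ [theta ->]].
    by move=> _ [theta _ <-]; rewrite psiE.
  - split; first by move=> F G _ _ FG eta GN v /FG/GN.
    by move=> C D _ _ CD v Dv eta /CD/Dv.
  move=> _ [theta _ <-]; rewrite psiE; split.
    by exists theta; rewrite NE; apply: cone_relint_self.
  by move=> eta; rewrite NE => /(max_face_relint s_neq0) ->.
move=> F [_ [theta ->]]; rewrite NE.
have [d [dimF dim_sigma dn]] := face_cone_dim s_neq0 theta.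
by exists d, (n - d)%N.
Qed.
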